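(* Let $G$ be a finitely generated group. Every finitely generated subgroup of $G_{bound}$ is virtually abelian.
   Context: For a finitely generated group $G$, a finite generating set $S$ of $G$ and $g\in G$, the word-length $l_S(g)$ is the minimal integer $n\ge 0$ such that $g$ is a product of $n$ elements of $S\cup S^{-1}$. $G_{bound}$ denotes the set of all $g\in G$ for which there exists a constant $M>0$ such that $l_S(g)<M$ for every finite generating set $S$ of $G$; it is a subgroup of $G$. *)

(* Defs.v *)
From mathcomp Require Import all_boot.
From mathcomp Require Import boolp classical_sets functions cardinality.

Set Implicit Arguments.
Unset Strict Implicit.
Unset Printing Implicit Defensive.

Local Open Scope classical_set_scope.
Local Open Scope group_scope.

(* [groupType] is the type of arbitrary, possibly infinite, groups; subgroups
   are Prop-valued sets, hence not assumed decidable. *)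

Definition is_subgroup (G : groupType) (H : set G) : Prop :=
  [/\ H 1,
      (forall x y : G, H x -> H y -> H (x * y))
    & (forall x : G, H x -> H x^-1)].

Definition generated (G : groupType) (S : set G) : set G :=
  smallest (@is_subgroup G) S.

Definition finite_generating_set (G : groupType) (H S : set G) : Prop :=
  finite_set S /\ generated S = H.

Definition finitely_generated (G : groupType) (H : set G) : Prop :=
  exists S : set G, finite_generating_set H S.

Definition product_of (G : groupType) (S : set G) (n : nat) (g : G) : Prop :=
  exists w : 'I_n -> G,
    (forall i, S (w i) \/ S (w i)^-1) /\ g = \prod_(i < n) w i.

(* The default value 0 is only taken when g is not in the subgroup generated
   by S, so never when S generates the whole group. *)
Definition word_length (G : groupType) (S : set G) (g : G) : nat :=
  xget 0%N [set n | product_of S n g /\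
                    forall m, product_of S m g -> (n <= m)%N].

Definition G_bound (G : groupType) : set G :=
  [set g | exists M : nat, (0 < M)%N /\
     forall S : set G, finite_generating_set [set: G] S ->
       (word_length S g < M)%N].

Definition abelian_set (G : groupType) (A : set G) : Prop :=
  forall x y : G, A x -> A y -> commute x y.

Definition left_coset (G : groupType) (A : set G) (x : G) : set G :=
  [set x * a | a in A].

Definition finite_index (G : groupType) (A H : set G) : Prop :=
  finite_set [set left_coset A x | x in H].

Definition virtually_abelian (G : groupType) (H : set G) : Prop :=
  exists A : set G,
    [/\ is_subgroup A, A `<=` H, abelian_set A & finite_index A H].

(* Main.v *)
Require Import Defs.
From mathcomp Require Import all_boot.
From mathcomp Require Import boolp classical_sets functions cardinality.

(** An element of [G_bound] with bound [M] has finitely many conjugates, and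
    this forces finitely generated subgroups to be virtually abelian.

    The first point: conjugation permutes the finite generating sets of [G], so
    the set of elements of length less than [M] for _all_ of them
    ([bounded_by M]) is invariant under conjugation ([bounded_byJ]).  It is
    contained in the ball of radius [M] of any single finite generating set,
    and such a ball is finite; hence the conjugacy class of each of its
    elements is finite ([G_bound_finite_class]).

    The second point: let [H] be generated by a finite set [T] of elements with
    finite conjugacy class.  The centre of [H] is the set of elements of [H]
    commuting with every [t] in [T], so the left coset of [x] modulo the centre is
    determined by the list of the conjugates of the elements of [T] by [x^-1].
    There are finitely many such lists, so the centre is an abelian subgroup
    of finite index ([virtually_abelian_of_finite_classes]). *)

Local Open Scope group_scope.
Local Open Scope classical_set_scope.

(** * Words in a generating set *)

Definition letter {G : groupType} (S : set G) : set G :=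
  [set s | S s \/ S s^-1].

Lemma product_of0 {G : groupType} (S : set G) (g : G) :
  product_of S 0 g <-> g = 1.
Proof.
split=> [[w [_ ->]]|->]; first by rewrite big_ord0.
by exists (fun=> 1); split=> [[]|] //; rewrite big_ord0.
Qed.

(** Peeling off the first letter replaces the indexed words by an induction on
    the length; the later facts about words use only this recursion. *)
Lemma product_ofS {G : groupType} (S : set G) (n : nat) (g : G) :
  product_of S n.+1 g <->
  exists s h : G, [/\ letter S s, product_of S n h & g = s * h].
Proof.
split=> [[w [Sw ->]]|[s [_ [Ss [w [Sw ->]] ->]]]].
  exists (w ord0), (\prod_(i < n) w (lift ord0 i)).
  split; [exact: Sw | | by rewrite big_ord_recl].
  by exists (fun i => w (lift ord0 i)).
exists (fun i => oapp w s (unlift ord0 i)); split=> [i|].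
  by case: unliftP => [j _|_] /=; [exact: Sw | exact: Ss].
rewrite big_ord_recl unlift_none /=; congr (_ * _).
by apply: eq_bigr => i _; rewrite liftK.
Qed.

Lemma product_ofM {G : groupType} (S : set G) (m n : nat) (g h : G) :
  product_of S m g -> product_of S n h -> product_of S (m + n) (g * h).
Proof.
elim: m g => [|m IHm] g; first by move=> /product_of0-> ; rewrite mul1g.
move=> /product_ofS[s [k [Ss Sk ->]]] Sh; apply/product_ofS.
by exists s, (k * h); split; rewrite ?mulgA //; apply: IHm.
Qed.

Lemma product_of_letter {G : groupType} (S : set G) (s : G) :
  letter S s -> product_of S 1 s.
Proof.
move=> Ss; apply/product_ofS; exists s, 1.
by split; rewrite ?mulg1 //; apply/product_of0.
Qed.

Lemma product_ofV {G : groupType} (S : set G) (n : nat) (g : G) :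
  product_of S n g -> product_of S n g^-1.
Proof.
elim: n g => [|n IHn] g.
  by move=> /product_of0->; apply/product_of0; rewrite invg1.
move=> /product_ofS[s [h [Ss Sh ->]]]; rewrite invgM -addn1.
apply: product_ofM; first exact: IHn.
by apply: product_of_letter; rewrite /letter /= invgK; case: Ss; [right|left].
Qed.

Lemma generated_product_of {G : groupType} (S : set G) (g : G) :
  generated S g -> exists n, product_of S n g.
Proof.
move=> /(_ [set g | exists n, product_of S n g]); apply.
split=> [|s Ss]; last by exists 1%N; apply: product_of_letter; left.
split; first by exists 0%N; apply/product_of0.
- by move=> x y [m Sx] [n Sy]; exists (m + n)%N; apply: product_ofM.
- by move=> x [n Sx]; exists n; apply: product_ofV.
Qed.

(** As [g] is generated by [S], the minimum defining the word length exists. *)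
Lemma product_of_word_length {G : groupType} (S : set G) (g : G) :
  generated S g -> product_of S (word_length S g) g.
Proof.
move=> /generated_product_of exn; rewrite /word_length.
have exb : exists n, `[< product_of S n g >].
  by case: exn => n Sg; exists n; apply/asboolP.
case: (ex_minnP exb) => n /asboolP Sg minn.
case: xgetP => [m _ []//|/(_ n) []]; split=> // m Sm.
by apply: minn; apply/asboolP.
Qed.

Lemma finite_product_of {G : groupType} (S : set G) (n : nat) :
  finite_set S -> finite_set [set g | product_of S n g].
Proof.
move=> finS; elim: n => [|n IHn].
  apply: sub_finite_set (finite_set1 (1 : G)) => g /=.
  by move=> /product_of0.
have finL : finite_set (letter S).
  apply: (@sub_finite_set _ _ (S `|` [set s^-1 | s in S])).
    by move=> s [Ss|Ss]; [left | right; exists s^-1; rewrite ?invgK].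
  by rewrite finite_setU; split=> //; apply: finite_image.
apply: sub_finite_set (finite_image2 (fun s h => s * h) finL IHn).
by move=> g /= /product_ofS[s [h [Ss Sh ->]]]; exists s => //; exists h.
Qed.

(** * Elements of bounded length have finitely many conjugates *)

Lemma product_ofJ {G : groupType} (S : set G) (n : nat) (x g : G) :
  product_of [set s ^ x | s in S] n g -> product_of S n (g ^ x^-1).
Proof.
elim: n g => [|n IHn] g.
  by move=> /product_of0->; apply/product_of0; rewrite conj1g.
move=> /product_ofS[s [h [Ss /IHn Sh ->]]]; apply/product_ofS.
exists (s ^ x^-1), (h ^ x^-1); split; rewrite ?conjMg //.
case: Ss => [[t St <-]|[t St tE]]; first by left; rewrite conjgK.
by right; rewrite -conjVg -tE conjgK.
Qed.

Lemma finite_generating_setJ {G : groupType} (S : set G) (x : G) :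
  finite_generating_set [set: G] S ->
  finite_generating_set [set: G] [set s ^ x | s in S].
Proof.
move=> [finS genS]; split; first exact: finite_image.
rewrite -subTset => y _ K [[K1 KM KV] SK].
(* The preimage of [K] under conjugation by [x] is a subgroup containing [S],
   hence is the whole group, and [y] is the image of [y ^ x^-1]. *)
have : generated S (y ^ x^-1) by rewrite genS.
move=> /(_ [set z | K (z ^ x)]) /=; rewrite conjgKV; apply.
split=> [|s Ss]; last by apply: SK; exists s.
split=> /= [|a b|a]; first by rewrite conj1g.
- by rewrite conjMg; apply: KM.
- by rewrite conjVg; apply: KV.
Qed.

(** Existence of a short word is used in place of the word length, which makes
    both the invariance under conjugation and the finiteness immediate. *)
Definition bounded_by {G : groupType} (M : nat) : set G :=
  [set g | forall S : set G, finite_generating_set [set: G] S ->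
     exists2 n, (n < M)%N & product_of S n g].

Lemma G_bound_bounded_by {G : groupType} (g : G) :
  @G_bound G g -> exists M, bounded_by M g.
Proof.
move=> [M [_ Mg]]; exists M => S genS; exists (word_length S g); first exact: Mg.
by apply: product_of_word_length; rewrite genS.2.
Qed.

Lemma bounded_byJ {G : groupType} (M : nat) (g x : G) :
  bounded_by M g -> bounded_by M (g ^ x).
Proof.
move=> Mg S /(finite_generating_setJ _ x^-1)/Mg[n ltnM /product_ofJ Sg].
by exists n; rewrite // -[x]invgK.
Qed.

Lemma finite_bounded_by {G : groupType} (M : nat) :
  finitely_generated [set: G] -> finite_set (@bounded_by G M).
Proof.
move=> [S genS].
apply: (@sub_finite_set _ _ (\bigcup_(n in `I_M) [set g | product_of S n g])).
  by move=> g /(_ S genS)[n ltnM Sg]; exists n.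
apply: bigcup_finite; first exact: finite_II.
by move=> n _; apply: finite_product_of; case: genS.
Qed.

Lemma G_bound_finite_class {G : groupType} (g : G) :
  finitely_generated [set: G] -> @G_bound G g ->
  finite_set [set g ^ x | x in [set: G]].
Proof.
move=> fgG /G_bound_bounded_by[M Mg].
apply: sub_finite_set (finite_bounded_by M fgG).
by move=> _ [x _ <-]; apply: bounded_byJ.
Qed.

(** * Finitely generated groups with finite conjugacy classes *)

Lemma finite_image_factor {A : choiceType} {B C : Type} (D : set A) (f : A -> B) (g : A -> C) :
  (forall x y, D x -> D y -> g x = g y -> f x = f y) ->
  finite_set [set g x | x in D] -> finite_set [set f x | x in D].
Proof.
move=> fg fing; have [->|/set0P[x0 Dx0]] := eqVneq D set0.
  by rewrite image_set0.
pose h c := f (xget x0 [set x | D x /\ g x = c]).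
apply: sub_finite_set (finite_image h fing).
move=> _ [x Dx <-]; exists (g x); first by exists x.
rewrite /h; case: xgetP => [y _ [Dy gyx]|/(_ x) []//].
exact: fg.
Qed.

Lemma finite_image_map {A : Type} {B : eqType} {C : Type} (D : set A)
    (f : A -> B -> C) (s : seq B) :
  (forall t, t \in s -> finite_set [set f x t | x in D]) ->
  finite_set [set [seq f x t | t <- s] | x in D].
Proof.
elim: s => [|t s IHs] fins.
  apply: sub_finite_set (finite_set1 [::]).
  by move=> _ [x _ <-].
have fint := fins t (mem_head _ _).
have {}IHs := IHs (fun u us => fins u (mem_behead (s := t :: s) us)).
apply: sub_finite_set (finite_image2 cons fint IHs).
move=> _ [x Dx <-] /=; exists (f x t); first by exists x.
by exists [seq f x u | u <- s] => //; exists x.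
Qed.

Lemma is_subgroup_centraliser {G : groupType} (T : set G) :
  is_subgroup [set x | forall t, T t -> commute x t].
Proof.
split=> /= [t _|x y cx cy t Tt|x cx t Tt].
- exact/commute_sym/commute1.
- by apply/commute_sym/commuteM; apply/commute_sym; [apply: cx | apply: cy].
- by apply/commute_sym/commuteV/commute_sym/cx.
Qed.

(** The centraliser of [x] is a subgroup containing [T]. *)
Lemma commute_generated {G : groupType} (T : set G) (x y : G) :
  (forall t, T t -> commute x t) -> generated T y -> commute x y.
Proof.
move=> cx /(_ [set z | forall t, [set x] t -> commute z t]) cy.
apply/commute_sym/cy => //; split; first exact: is_subgroup_centraliser.
by move=> t Tt _ ->; apply/commute_sym/cx.
Qed.

Lemma left_coset_eq {G : groupType} (A : set G) (x y : G) :
  is_subgroup A -> A (x^-1 * y) -> left_coset A x = left_coset A y.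
Proof.
move=> [_ AM AV] Axy; apply/seteqP; split=> _ [a Aa <-].
  exists ((x^-1 * y)^-1 * a); first by apply: AM => //; apply: AV.
  by rewrite invgM invgK !mulgA mulgV mul1g.
exists (x^-1 * y * a); first exact: AM.
by rewrite !mulgA mulgV mul1g.
Qed.

Lemma virtually_abelian_of_finite_classes {G : groupType} (H : set G) :
  is_subgroup H -> finitely_generated H ->
  (forall h, H h -> finite_set [set h ^ x | x in H]) ->
  virtually_abelian H.
Proof.
move=> sgH [T [finT genT]] finJ; have [H1 HM HV] := sgH.
have TH t : T t -> H t by move=> Tt; rewrite -genT => K [_]; apply.
pose C := [set x : G | forall t, T t -> commute x t].
have [C1 CM CV] : is_subgroup C by apply: is_subgroup_centraliser.
have sgA : is_subgroup (H `&` C).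
  split=> [|x y [Hx Cx] [Hy Cy]|x [Hx Cx]]; first by split.
  - by split; [apply: HM | apply: CM].
  - by split; [apply: HV | apply: CV].
exists (H `&` C); split=> [//|x []//|x y [_ Cx] [Hy _]|].
  by apply: commute_generated Cx _; rewrite genT.
have [s sT] := (finite_seqP T).1 finT.
(* [x^-1] appears because [_ ^ x] depends on the right coset of [x] modulo the
   centraliser, while the index counts left cosets. *)
apply: (@finite_image_factor _ _ _ H _ (fun x => [seq t ^ x^-1 | t <- s])).
  move=> x y Hx Hy eqJ; apply: left_coset_eq => //; split.
    by apply: HM => //; apply: HV.
  move=> t; rewrite sT /= => ts.
  have eqt : t ^ x^-1 = t ^ y^-1 by move/eq_in_map: eqJ; apply.
  have fixt : t ^ (y^-1 * x) = t by rewrite conjgM -eqt conjgKV.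
  rewrite -[x^-1 * y]invgK invgM invgK; apply/commute_sym/commuteV.
  exact/commgP/conjg_fixP.
apply: finite_image_map => t ts.
have Ht : H t by apply: TH; rewrite sT.
apply: sub_finite_set (finJ t Ht).
by move=> _ [x Hx <-]; exists x^-1 => //; apply: HV.
Qed.

Theorem corollary2p7 (G : groupType) (H : set G)
  (fgG : finitely_generated [set: G])
  (sgH : is_subgroup H)
  (sHB : H `<=` @G_bound G)
  (fgH : finitely_generated H) :
  virtually_abelian H.
Proof.
apply: virtually_abelian_of_finite_classes => // h /sHB Bh.
apply: sub_finite_set (G_bound_finite_class h fgG Bh).
by move=> _ [x _ <-]; exists x.
Qed.
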